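(* Let $c>0$ be a constant and $p=c/n$. Let $\Delta$ denote the maximum degree of $G_{n,p}$. Then with high probability \[\tau_2(G_{n,p})=\left\lceil \frac{\sqrt{8\Delta+1}+5}{2}\right\rceil.\]
   Context: For a positive integer $t$ and a graph $G$, a (proper) $t$-tone $k$-coloring of $G$ is a function $f:V(G)\to\binom{[k]}{t}$ such that $|f(u)\cap f(v)|<d(u,v)$ for all distinct vertices $u,v$, where $d(u,v)$ is the graph distance. For $t=2$: adjacent vertices receive disjoint labels and vertices at distance $2$ receive distinct labels. $\tau_t(G)$ is the least $k$ for which a $t$-tone $k$-coloring exists. $G_{n,p}$ is the Erdős–Rényi random graph on $[n]$; ''with high probability'' means with probability $\to1$ as $n\to\infty$. *)

(* Defs.v *)
From Stdlib Require Import Reals ClassicalEpsilon.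
From mathcomp Require Import all_boot.

(* A simple graph on vertex set 'I_n is a set E of 2-element subsets. *)
Definition pairs (n : nat) : {set {set 'I_n}} := [set s : {set 'I_n} | #|s| == 2].

Definition graphs (n : nat) : {set {set {set 'I_n}}} := powerset (pairs n).

Definition adj {n : nat} (E : {set {set 'I_n}}) (u v : 'I_n) : bool :=
  [set u; v] \in E.

(* within E k u v  <=>  d(u,v) <= k  (there is a walk of length <= k). *)
Fixpoint within {n : nat} (E : {set {set 'I_n}}) (k : nat) (u v : 'I_n) : bool :=
  match k with
  | 0 => u == v
  | k'.+1 => within E k' u v || [exists w, within E k' u w && adj E w v]
  end.

(* A (proper) t-tone k-coloring: labels are t-subsets of [k] (here 'I_k),
   and |f u ∩ f v| < d(u,v) for distinct u, v, i.e. NOT d(u,v) <= |f u ∩ f v|.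
   (Infinite distance imposes no constraint.) *)
Definition tone_coloring {n : nat} (E : {set {set 'I_n}}) (t k : nat)
    (f : 'I_n -> {set 'I_k}) : Prop :=
  (forall v, #|f v| = t) /\
  (forall u v, u != v -> ~~ within E #|f u :&: f v| u v).

Definition has_tone_coloring {n : nat} (E : {set {set 'I_n}}) (t k : nat) : Prop :=
  exists f : 'I_n -> {set 'I_k}, tone_coloring E t k f.

Definition is_tau {n : nat} (E : {set {set 'I_n}}) (t m : nat) : Prop :=
  has_tone_coloring E t m /\ (forall k, (k < m)%N -> ~ has_tone_coloring E t k).

Definition max_degree {n : nat} (E : {set {set 'I_n}}) : nat :=
  \max_(v : 'I_n) #|[set u | adj E u v]|.

Definition gnp_weight (n : nat) (p : R) (E : {set {set 'I_n}}) : R :=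
  Rmult (pow p #|E|) (pow (Rminus 1 p) (#|pairs n| - #|E|)).

Definition gnp_prob (n : nat) (p : R) (P : {set {set 'I_n}} -> Prop) : R :=
  \big[Rplus/R0]_(E in graphs n)
     (if excluded_middle_informative (P E) then gnp_weight n p E else R0).

Definition is_ceil (m : nat) (y : R) : Prop :=
  Rlt (Rminus (INR m) 1) y /\ Rle y (INR m).

(* Main.v *)
Require Import Defs.
From Stdlib Require Import Reals.
From Stdlib Require Lra.
From mathcomp Require Import all_boot all_order all_algebra zify ring lra.
From mathcomp Require Import Rstruct.

(** The star at a vertex of maximum degree D forces D <= 'C(k - 2, 2), and the
    ceiling is the least such k.  Conversely, fix a large constant s and call a
    vertex high if its degree exceeds s.  With high probability D exceeds any
    constant, and every nonempty vertex set S of size at most 13 times the number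
    of high vertices spans fewer than 14/13 |S| edges.  Then every nonempty set A
    of high vertices contains an h with at most three neighbours v from which a
    path of length at most 3 avoiding the edge vh leads to A: otherwise the union
    of four such paths for each h in A would be too dense.  Peeling off such
    vertices orders the high vertices; in the reverse order each one is coloured
    together with its neighbours, the few exceptional neighbours first, as the
    remaining ones only have to avoid the label of h and each other, for which
    'C(k - 2, 2) labels are enough.  The vertices that are neither high nor
    adjacent to a high one see boundedly many vertices within distance 2 and are
    coloured greedily. *)

Set Implicit Arguments.
Unset Strict Implicit.
Unset Printing Implicit Defensive.

Import Order.TTheory GRing.Theory Num.Theory.

(** * Extending partial 2-tone colourings *)

Lemma card_bigcup_le (I T : finType) (P : {set I}) (B : I -> {set T}) m :
  {in P, forall i, #|B i| <= m} -> #|\bigcup_(i in P) B i| <= #|P| * m.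
Proof.
move=> le; apply: (@leq_trans (\sum_(i in P) #|B i|)); last first.
  by rewrite -sum_nat_const; apply: leq_sum.
elim/big_rec2: _ => [|i c A _ IH]; first by rewrite cards0.
by rewrite (leq_trans (leq_card_setU _ _)) // leq_add2l.
Qed.

Section Graph.
Variables (n : nat) (E : {set {set 'I_n}}).
Hypothesis EG : E \in graphs n.
Implicit Types (u v w x y h : 'I_n) (A C S : {set 'I_n}).

Definition nbr v : {set 'I_n} := [set u | adj E u v].
(** [nbr2 v] may contain neighbours of [v], namely those in a common triangle; labels of size 2 that
    are disjoint are distinct anyway. *)
Definition nbr2 v : {set 'I_n} :=
  [set u | (u != v) && [exists w, adj E u w && adj E w v]].
Definition cnbr A : {set 'I_n} := A :|: [set v | [exists u in A, adj E u v]].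

Lemma adjC u v : adj E u v = adj E v u.
Proof. by rewrite /adj setUC. Qed.

Lemma adj_neq u v : adj E u v -> u != v.
Proof.
move=> uv; move: EG; rewrite /graphs inE => /subsetP /(_ _ uv); rewrite inE cards2.
by case: (u != v).
Qed.

Lemma adjxx v : adj E v v = false.
Proof. by apply/negP => /adj_neq; rewrite eqxx. Qed.

Lemma in_nbr u v : (u \in nbr v) = adj E u v.
Proof. by rewrite inE. Qed.

Lemma cnbrP A v : reflect (v \in A \/ exists2 u, u \in A & adj E u v) (v \in cnbr A).
Proof.
rewrite !inE; apply: (iffP orP) => -[vA|].
- by left.
- by case/existsP=> u /andP[uA uv]; right; exists u.
- by left.
- by case=> u uA uv; right; apply/existsP; exists u; rewrite uA.
Qed.

Lemma cnbrS A (B : {set _}) : A \subset B -> cnbr A \subset cnbr B.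
Proof.
move=> /subsetP AB; apply/subsetP => v /cnbrP vA; apply/cnbrP.
by case: vA => [/AB|[u /AB uB uv]]; [left | right; exists u].
Qed.

Section Colors.
Variable k : nat.

(** Adjacency and common neighbours are taken in the whole graph and only the two ends must lie in
    [C], so a colouring of [C] never has to be revised when [C] grows. *)
Definition partial_tone C (f : 'I_n -> {set 'I_k}) : Prop :=
  [/\ {in C, forall v, #|f v| = 2},
      {in C &, forall u v, adj E u v -> [disjoint f u & f v]} &
      {in C &, forall u v, u \in nbr2 v -> f u != f v}].

Definition tonable C : Prop := exists f, partial_tone C f.

Lemma tonable_setT : tonable setT -> has_tone_coloring E 2 k.
Proof.
case=> f [f2 fadj fnbr2]; exists f; split=> [v|u v uv]; first exact: f2.
have /= le2 : #|f u :&: f v| <= 2 by rewrite -(f2 u) ?inE // subset_leq_card ?subsetIl.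
(* By the overlap i of the two labels: i = 0 only asks for u != v, i = 1 excludes adjacency, and i =
   2 means equal labels, to be excluded up to distance 2. *)
move def_i: #|f u :&: f v| le2 => i; case: i def_i => [|[|[|//]]] def_i _ //=.
  rewrite (negPf uv) /=; apply/existsP => -[w /andP[/eqP <- {w} auv]].
  have := fadj u v (in_setT _) (in_setT _) auv.
  by rewrite -setI_eq0 -cards_eq0 def_i.
have fuv : f u = f v.
  have /eqP <- : f u :&: f v == f u by rewrite eqEcard subsetIl def_i f2 ?inE.
  by apply/eqP; rewrite eqEcard subsetIr def_i f2 ?inE.
have nadj : ~~ adj E u v.
  apply/negP => auv; have := fadj u v (in_setT _) (in_setT _) auv.
  by rewrite -setI_eq0 -cards_eq0 def_i.
rewrite (negPf uv) /=; apply/norP; split.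
  by apply/existsP => -[w /andP[/eqP <- auv]]; rewrite auv in nadj.
apply/existsP => -[w /andP[/orP[/eqP <-|/existsP[x /andP[/eqP <- uw]]] wv]].
  by rewrite wv in nadj.
have /(fnbr2 u v (in_setT _) (in_setT _)) : u \in nbr2 v.
  by rewrite inE uv; apply/existsP; exists w; rewrite uw.
by rewrite fuv eqxx.
Qed.

Lemma nbr2C u v : (u \in nbr2 v) = (v \in nbr2 u).
Proof.
rewrite !inE eq_sym; congr (_ && _); apply/existsP/existsP => -[w /andP[a b]];
by exists w; rewrite adjC b adjC.
Qed.

Lemma partial_tone_extend C f v (L : {set 'I_k}) :
  partial_tone C f -> v \notin C -> #|L| = 2 ->
  {in nbr v :&: C, forall u, [disjoint L & f u]} ->
  {in nbr2 v :&: C, forall u, L != f u} ->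
  tonable (v |: C).
Proof.
case=> f2 fadj fnbr2 vC L2 Ladj Lnbr2.
exists (fun u => if u == v then L else f u); split.
- move=> u; rewrite !inE; case: eqVneq => //= _; exact: f2.
- move=> u w; rewrite !inE; case: (eqVneq u v) => [->|uv] /=;
    case: (eqVneq w v) => [->|wv] //=.
  + by rewrite adjxx.
  + by move=> _ wC vw; apply: Ladj; rewrite !inE wC adjC vw.
  + by move=> uC _ uw; rewrite disjoint_sym; apply: Ladj; rewrite in_setI in_nbr uw.
  + exact: fadj.
- move=> u w; rewrite 2!in_setU1; case: (eqVneq u v) => [->|uv] /=;
    case: (eqVneq w v) => [->|wv] //=.
  + by rewrite inE eqxx.
  + by move=> _ wC vw; apply: Lnbr2; rewrite in_setI wC nbr2C vw.
  + by move=> uC _ uw; rewrite eq_sym; apply: Lnbr2; rewrite in_setI uC uw.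
  + exact: fnbr2.
Qed.

Definition labels : {set {set 'I_k}} := [set L : {set 'I_k} | #|L| == 2].

Lemma card_labels : #|labels| = 'C(k, 2).
Proof. by rewrite card_draws card_ord. Qed.

Lemma card_labels_meeting (M : {set 'I_k}) :
  #|M| = 2 -> #|[set L in labels | ~~ [disjoint L & M]]| <= 2 * k.
Proof.
move=> M2.
apply: (@leq_trans #|[set [set ij.1; ij.2] | ij in setX M [set: 'I_k]]|); last first.
  by apply: leq_trans (leq_imset_card _ _) _; rewrite cardsX cardsT card_ord M2.
apply/subset_leq_card/subsetP => L; rewrite 2!inE -setI_eq0.
case/andP=> /cards2P[a [b [ab ->]]] /set0Pn[i]; rewrite !inE => /andP[/orP[]/eqP -> iM].
- by apply/imsetP; exists (a, b) => //; rewrite !inE iM.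
- by apply/imsetP; exists (b, a); rewrite ?inE ?iM // setUC.
Qed.

(** Each coloured neighbour of [v] rules out at most 2k labels, and each coloured vertex of [nbr2 v]
    rules out one. *)
Lemma tonable_greedy C v a b :
  tonable C -> v \notin C -> #|nbr v :&: C| <= a -> #|nbr2 v :&: C| <= b ->
  2 * k * a + b < 'C(k, 2) -> tonable (v |: C).
Proof.
case=> f Cf vC lea leb lt_lab.
pose bad1 := \bigcup_(u in nbr v :&: C) [set L in labels | ~~ [disjoint L & f u]].
pose bad2 := [set f u | u in nbr2 v :&: C].
have card1 : #|bad1| <= 2 * k * a.
  apply: leq_trans (card_bigcup_le (m := 2 * k) _) _; last by rewrite mulnC leq_mul2l lea orbT.
  move=> u; rewrite inE => /andP[_ uC]; apply: card_labels_meeting.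
  by case: Cf => f2 _ _; exact: f2.
have card2 : #|bad2| <= b by apply: leq_trans (leq_imset_card _ _) leb.
have /card_gt0P[L] : 0 < #|labels :\: (bad1 :|: bad2)|.
  have := cardsD labels (bad1 :|: bad2); rewrite card_labels => ->; rewrite subn_gt0.
  apply: leq_ltn_trans lt_lab; apply: leq_trans (leq_add card1 card2).
  exact: leq_trans (subset_leq_card (subsetIr _ _)) (leq_card_setU _ _).
rewrite in_setD in_setU negb_or -andbA => /and3P[Lbad1 Lbad2]; rewrite inE => L2.
apply: (partial_tone_extend Cf (L := L)) => //; first exact/eqP.
- move=> u uN; apply: contraNT Lbad1 => Lu; apply/bigcupP; exists u => //.
  by rewrite 2!inE L2.
- by move=> u uN; apply: contraNneq Lbad2 => ->; apply: imset_f.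
Qed.

(** The label of [h] leaves 'C(k - 2, 2) candidates. All other constraints come from coloured
    neighbours of [h]; these are fewer than the degree of [h], as [v] itself is still uncoloured, so
    a candidate remains. *)
Lemma tonable_leaf C h v :
  tonable C -> v \notin C -> h \in C -> adj E h v ->
  nbr v :&: C \subset [set h] -> nbr2 v :&: C \subset nbr h ->
  #|nbr h| <= 'C(k - 2, 2) -> tonable (v |: C).
Proof.
case=> f Cf vC hC hv sub1 sub2 ledeg.
have [f2 _ _] := Cf.
pose free := [set L : {set 'I_k} | L \subset ~: f h & #|L| == 2].
pose bad2 := [set f u | u in nbr2 v :&: C].
have card2 : #|bad2| < 'C(k - 2, 2).
  apply: leq_ltn_trans (leq_imset_card _ _) _; apply: leq_trans ledeg.
  apply: proper_card; apply/properP; split=> //; exists v; first by rewrite in_nbr adjC.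
  by rewrite inE (negPf vC) andbF.
have cardf : #|free| = 'C(k - 2, 2).
  by rewrite cards_draws cardsCs setCK card_ord f2.
have /card_gt0P[L] : 0 < #|free :\: bad2|.
  rewrite cardsD cardf subn_gt0; apply: leq_ltn_trans card2.
  exact: subset_leq_card (subsetIr _ _).
rewrite !inE => /and3P[Lbad2 Lh /eqP L2].
apply: (partial_tone_extend Cf (L := L)) => //.
- move=> u /(subsetP sub1); rewrite inE => /eqP ->.
  by rewrite disjoints_subset.
- by move=> u uN; apply: contraNneq Lbad2 => ->; apply: imset_f.
Qed.

Lemma tonable_iter C0 A :
  (forall C v, C0 \subset C -> C \subset C0 :|: A -> v \in A -> v \notin C ->
     tonable C -> tonable (v |: C)) ->
  tonable C0 -> tonable (C0 :|: A).
Proof.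
move=> step C0ton.
suff gen m C : #|A :\: C| = m -> C0 \subset C -> C \subset C0 :|: A -> tonable C ->
    tonable (C0 :|: A).
  exact: (gen _ C0 erefl (subxx _) (subsetUl _ _) C0ton).
elim: m C => [|m IH] C.
  move/eqP; rewrite cards_eq0 setD_eq0 => AC C0C CA.
  suff -> : C0 :|: A = C by [].
  by apply/eqP; rewrite eqEsubset CA subUset C0C AC.
move=> cardm C0C CA Cton.
have /card_gt0P[v] : 0 < #|A :\: C| by rewrite cardm.
rewrite inE => /andP[vC vA]; apply: (IH (v |: C)).
- have := cardsD1 v (A :\: C); rewrite cardm inE vC vA add1n => -[->].
  by apply: eq_card => u; rewrite !inE; case: (u == v).
- exact: subset_trans C0C (subsetUr _ _).
- by rewrite subUset CA sub1set inE vA orbT.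
- exact: step.
Qed.

End Colors.
End Graph.

(** * Colouring along a peeling order of the high vertices *)

Section Peeling.
Variables (n : nat) (E : {set {set 'I_n}}).
Hypothesis EG : E \in graphs n.
Implicit Types (u v w x y h : 'I_n) (A B C H S X : {set 'I_n}).

Local Notation nbr := (nbr E).
Local Notation nbr2 := (nbr2 E).
Local Notation cnbr := (cnbr E).

(** The exceptional neighbours. For h in A, a neighbour v of h outside this set has h as its only
    neighbour in [cnbr A], and its walks of length 2 to other vertices of [cnbr A] all pass through
    h, so that [tonable_leaf] applies to it. *)
Definition special A h : {set 'I_n} :=
  [set v in nbr h | (v \in A) || [exists x, [&& adj E v x, x != h &
     (x \in A) || [exists u, [&& adj E x u, u != v & u \in cnbr A]]]]].

(** The neighbours of [x] through which colours inside [cnbr A] can constrain [x], as coloured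
    vertices or as middle vertices of walks of length 2. Even for a high [x] the peeling keeps this
    set small. *)
Definition linked A x : {set 'I_n} :=
  [set y in nbr x | (y \in cnbr A) || [exists u, [&& u != x, adj E y u & u \in cnbr A]]].

Lemma specialI A h v : adj E h v ->
  v \in A \/ (exists x, [/\ adj E v x, x != h &
     x \in A \/ exists u, [/\ adj E x u, u != v & u \in cnbr A]]) ->
  v \in special A h.
Proof.
move=> hv cond; rewrite inE in_nbr adjC hv /=; apply/orP.
case: cond => [->|[x [vx xh cond]]]; [by left|right].
apply/existsP; exists x; rewrite vx xh /=.
case: cond => [->//|[u [xu uv uA]]]; apply/orP; right.
by apply/existsP; exists u; rewrite xu uv uA.
Qed.

Lemma linkedI A x y : adj E y x ->
  y \in cnbr A \/ (exists u, [/\ u != x, adj E y u & u \in cnbr A]) ->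
  y \in linked A x.
Proof.
move=> yx cond; rewrite inE in_nbr yx /=; apply/orP.
case: cond => [->|[u [ux yu uA]]]; [by left|right].
by apply/existsP; exists u; rewrite ux yu uA.
Qed.

Lemma linkedS A B x : A \subset B -> linked A x \subset linked B x.
Proof.
move=> AB; apply/subsetP => y; rewrite inE in_nbr => /andP[yx /orP cond].
apply: linkedI => //; have /subsetP sAB := cnbrS E AB.
case: cond => [/sAB|/existsP[u /and3P[ux yu /sAB uB]]]; first by left.
by right; exists u.
Qed.

(** From a linked neighbour y of [h] at most two more edges lead to [H :\ h], so y starts one of the
    short paths that define [special]. The peeling bound thus also bounds the links of [h]. *)
Lemma linked_special H h : h \in H -> linked (H :\ h) h \subset special H h.
Proof.
move=> hH; apply/subsetP => y; rewrite inE in_nbr => /andP[yh cond].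
apply: specialI; first by rewrite adjC.
case: (boolP (y \in H)) => yH; [by left | right].
case/orP: cond => [/cnbrP[]|].
- by rewrite !inE (negPf yH) andbF.
- case=> x; rewrite !inE => /andP[xh xH] xy; exists x; rewrite adjC xy xh; split=> //.
  by left.
- case/existsP=> u /and3P[uh yu /cnbrP[]].
    by rewrite !inE uh => uH; exists u; split=> //; left.
  case=> x; rewrite !inE => /andP[xh xH] xu; exists u; split=> //; right.
  exists x; rewrite adjC xu; split=> //; first by apply: contraNneq yH => <-.
  by apply/cnbrP; left.
Qed.

Lemma card_nbr2_le C v X b :
  (forall x u, adj E x v -> adj E u x -> u != v -> u \in C -> x \in X) ->
  {in X, forall x, #|nbr x :&: C| <= b} -> #|nbr2 v :&: C| <= #|X| * b.
Proof.
move=> inX leb; apply: (@leq_trans #|\bigcup_(x in X) (nbr x :&: C)|).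
  apply/subset_leq_card/subsetP => u; rewrite in_setI inE.
  case/andP=> /andP[uv /existsP[x /andP[ux xv]]] uC.
  by apply/bigcupP; exists x; [apply: (inX x u) | rewrite in_setI in_nbr ux].
exact: card_bigcup_le.
Qed.

Section Bounds.
Variables (k s : nat) (H : {set 'I_n}).
Hypothesis low : forall v, v \notin H -> #|nbr v| <= s.
Hypothesis peel : forall A, A \subset H -> A != set0 ->
  exists2 h, h \in A & #|special A h| <= s.
Hypothesis k_large : 2 * k * s + (s * s + s) < 'C(k, 2).
Hypothesis deg_le : forall v, #|nbr v| <= 'C(k - 2, 2).

(** Induction on #|A|, removing a peelable h. The hypothesis on [linked] is the invariant: it passes
    to [A :\ h] by monotonicity for the vertices already outside, and by [linked_special] for h. The
    colouring of [cnbr (A :\ h)] is then extended to h, to [special A h] and finally to the rest of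
    [nbr h]. *)
Lemma tonable_cnbr A : A \subset H ->
  (forall x, x \in H -> x \notin A -> #|linked A x| <= s) -> tonable E k (cnbr A).
Proof.
elim: {A}#|A| {-2}A (erefl #|A|) => [|m IH] A.
  move/eqP; rewrite cards_eq0 => /eqP -> _ _.
  have -> : cnbr set0 = set0.
    by apply/setP => v; rewrite [RHS]inE; apply/negP => /cnbrP[|[u]]; rewrite inE.
  by exists (fun _ => set0); split=> u; rewrite inE.
move=> cardA AH linkA.
have [h hA leh] : exists2 h, h \in A & #|special A h| <= s.
  by apply: peel => //; rewrite -cards_eq0 cardA.
pose A0 := A :\ h; pose C0 := cnbr A0.
have A0A : A0 \subset A by exact: subD1set.
have C0A : C0 \subset cnbr A by exact: cnbrS.
have A0C0 v : v \in A0 -> v \in C0 by move=> vA0; apply/cnbrP; left.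
have hcA : h \in cnbr A by apply/cnbrP; left.
have hNcA : nbr h \subset cnbr A.
  by apply/subsetP => v; rewrite in_nbr => vh; apply/cnbrP; right; exists h; rewrite 1?adjC.
have notA v : v != h -> v \notin A0 -> v \notin A by move=> vh; rewrite !inE vh.
have linkh : linked A0 h \subset special A h by exact: linked_special.
have C0ton : tonable E k C0.
  apply: IH; first by apply/eqP; rewrite -(eqn_add2l (h \in A)) -cardsD1 cardA hA.
    exact: subset_trans A0A AH.
  move=> x xH; rewrite !inE negb_and negbK => /orP[/eqP->|xA].
    exact: leq_trans (subset_leq_card linkh) leh.
  exact: leq_trans (subset_leq_card (linkedS _ A0A)) (linkA _ xH xA).
have linkle v : v \notin A -> #|linked A v| <= s.
  move=> vA; case: (boolP (v \in H)) => vH; first exact: linkA.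
  apply: leq_trans (low vH); apply/subset_leq_card/subsetP => y.
  by rewrite inE => /andP[].
have nbrle C v : C \subset cnbr A -> v \notin A -> #|nbr v :&: C| <= s.
  move=> /subsetP CA vA; apply: leq_trans (linkle v vA).
  apply/subset_leq_card/subsetP => y; rewrite in_setI in_nbr => /andP[yv /CA yA].
  by apply: linkedI => //; left.
pose C1 := h |: C0.
have C1ton : tonable E k C1.
  (* h is already coloured if it is adjacent to another vertex of A. Otherwise its links are
     special, hence at most s in number, and lie outside A, so each of them sees at most s coloured
     vertices. *)
  case: (boolP (h \in C0)) => hC0.
    by rewrite /C1; have/setUidPr -> : [set h] \subset C0 by rewrite sub1set.
  apply: (tonable_greedy (a := s) (b := s * s) EG C0ton hC0); last first.
  - by apply: leq_ltn_trans k_large; rewrite leq_add2l leq_addr.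
  - apply: (@leq_trans (#|linked A0 h| * s)).
      apply: card_nbr2_le => [x u xh ux uh uC0|x].
        by apply: linkedI => //; right; exists u; rewrite adjC.
      rewrite inE in_nbr => /andP[xh _]; apply: nbrle => //; apply: notA.
        exact: (adj_neq EG xh).
      by apply: contra hC0 => xA0; apply/cnbrP; right; exists x.
    by rewrite leq_mul2r (leq_trans (subset_leq_card linkh) leh) orbT.
  - apply: leq_trans leh; apply: leq_trans (subset_leq_card linkh).
    apply/subset_leq_card/subsetP => y; rewrite in_setI in_nbr => /andP[yh yC0].
    by apply: linkedI => //; left.
pose C2 := C1 :|: special A h.
have spN : special A h \subset nbr h by apply/subsetP => v; rewrite inE => /andP[].
have C2A : C2 \subset cnbr A.
  by rewrite subUset subUset sub1set hcA C0A (subset_trans spN).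
have C2ton : tonable E k C2.
  apply: tonable_iter C1ton => C v C1C CC2 vsp vC Cton.
  have C0C : C0 \subset C by apply: subset_trans C1C; exact: subsetUr.
  have hC : h \in C by apply: (subsetP C1C); rewrite !inE eqxx.
  have vh : v != h by apply: contraNneq vC => ->.
  have CA := subset_trans CC2 C2A.
  have vA : v \notin A.
    by apply: notA => //; apply: contra vC => /A0C0; exact: subsetP.
  apply: (tonable_greedy (a := s) (b := s * s + s) EG Cton vC) => //.
    exact: nbrle.
  (* A middle vertex is h or is linked to v. At this stage all coloured neighbours of h are special,
     so h contributes at most s vertices too; this is the summand s in [k_large]. *)
  apply: (@leq_trans (#|h |: linked A v| * s)); last first.
    rewrite addnC -mulSn leq_mul2r; apply/orP; right.
    by rewrite cardsU1 (leq_add (leq_b1 _)) ?linkle.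
  apply: card_nbr2_le => [x u xv ux uv uC|x].
    rewrite in_setU1; apply/orP; right.
    apply: linkedI => //; right; exists u; rewrite uv adjC ux; split=> //.
    exact: (subsetP CA).
  rewrite in_setU1; case: (eqVneq x h) => [-> _|xh /=].
    apply: leq_trans leh; apply/subset_leq_card/subsetP => u.
    rewrite in_setI in_nbr => /andP[uh /(subsetP CC2)].
    rewrite in_setU in_setU1 (negPf (adj_neq EG uh)) /= => /orP[uC0|//].
    by apply: (subsetP linkh); apply: linkedI => //; left.
  rewrite inE in_nbr => /andP[xv _]; apply: nbrle => //; apply: notA => //.
  by apply: contra vC => xA0; apply: (subsetP C0C); apply/cnbrP; right; exists x.
have -> : cnbr A = C2 :|: nbr h.
  have C2N : C2 :|: nbr h \subset cnbr A by rewrite subUset C2A.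
  apply/eqP; rewrite eqEsubset C2N andbT.
  apply/subsetP => v /cnbrP[vA|[u uA uv]].
    rewrite 2!in_setU in_setU1; case: eqVneq => //= vh.
    by rewrite A0C0 // !inE vh.
  rewrite in_setU in_nbr; case: (eqVneq u h) => [<-|uh].
    by rewrite [adj E v u]adjC uv orbT.
  rewrite in_setU in_setU1; suff -> : v \in C0 by rewrite !orbT.
  by apply/cnbrP; right; exists u; rewrite // !inE uh.
apply: tonable_iter C2ton => C v C2C CA' vN vC Cton.
have CA : C \subset cnbr A by apply: subset_trans CA' _; rewrite subUset C2A.
have hC : h \in C by apply: (subsetP C2C); rewrite !inE eqxx.
have C0C : C0 \subset C.
  by apply: subset_trans C2C; rewrite /C2 /C1 -setUA subsetU // subsetUl orbT.
have vh : v != h by apply: contraNneq vC => ->.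
have hv : adj E h v by rewrite adjC -in_nbr.
have vA : v \notin A.
  by apply: notA => //; apply: contra vC => /A0C0; exact: subsetP.
have vsp : v \notin special A h.
  by apply: contra vC => vsp; apply: (subsetP C2C); rewrite inE vsp orbT.
apply: (tonable_leaf EG Cton vC hC) => //.
- apply/subsetP => x; rewrite in_setI in_nbr => /andP[xv /(subsetP CA) /cnbrP xA].
  rewrite in_set1; apply: contraNT vsp => xh; apply: specialI => //; right.
  exists x; rewrite adjC; split=> //; case: xA => [|[u uA ux]]; [by left | right].
  exists u; rewrite adjC; split=> //; first by apply: contraNneq vA => <-.
  by apply/cnbrP; left.
- apply/subsetP => u; rewrite in_setI inE => /andP[/andP[uv /existsP[w /andP[uw wv]]] uC].
  rewrite in_nbr; case: (eqVneq w h) => [<-//|wh].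
  case/negP: vsp; apply: specialI => //; right; exists w; rewrite adjC; split=> //.
  by right; exists u; rewrite adjC; split=> //; exact: (subsetP CA).
Qed.

Lemma tonable_peel : tonable E k setT.
Proof.
rewrite -(setUT (cnbr H)); apply: tonable_iter; last first.
  by apply: tonable_cnbr => // x ->.
move=> C v HC _ _ vC Cton.
have vH : v \notin H.
  by apply: contra vC => vH; apply: (subsetP HC); apply/cnbrP; left.
apply: (tonable_greedy (a := s) (b := s * s) EG Cton vC); last first.
- by apply: leq_ltn_trans k_large; rewrite leq_add2l leq_addr.
- apply: (@leq_trans (#|nbr v| * s)).
    apply: card_nbr2_le => [x u xv _ _ _|x]; first by rewrite in_nbr.
    rewrite in_nbr => xv; apply: leq_trans (subset_leq_card (subsetIl _ _)) _.
    apply: low; apply: contra vC => xH; apply: (subsetP HC); apply/cnbrP.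
    by right; exists x.
  by rewrite leq_mul2r low ?orbT.
- exact: leq_trans (subset_leq_card (subsetIl _ _)) (low vH).
Qed.
End Bounds.
End Peeling.

(** * Peeling in sparse graphs *)

Definition induced n (E : {set {set 'I_n}}) (S : {set 'I_n}) : {set {set 'I_n}} :=
  [set e in E | e \subset S].

Definition arcs n (E : {set {set 'I_n}}) (S : {set 'I_n}) : {set 'I_n * 'I_n} :=
  [set p | [&& p.1 \in S, p.2 \in S & adj E p.1 p.2]].

Lemma card_arcs_le n (E : {set {set 'I_n}}) S : E \in graphs n ->
  #|arcs E S| <= 2 * #|induced E S|.
Proof.
move=> EG; pose g (p : 'I_n * 'I_n) := [set p.1; p.2].
rewrite -sum1_card (partition_big g (mem (induced E S))) /=; last first.
  move=> [a b]; rewrite inE => /and3P[/= aS bS ab].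
  by rewrite inE subUset !sub1set aS bS !andbT.
rewrite mulnC -sum_nat_const; apply: leq_sum => e; rewrite inE => /andP[eE _].
have /cards2P[a [b [ab ->]]] : #|e| == 2.
  by move: EG; rewrite inE => /subsetP /(_ _ eE); rewrite inE.
rewrite sum1_card; apply: (@leq_trans #|[set (a, b); (b, a)]|); last first.
  by rewrite cards2; case: (_ != _).
apply/subset_leq_card/subsetP => -[x y]; rewrite unfold_in /= => /andP[].
rewrite inE /= => /and3P[_ _ xy] /eqP gab; have := adj_neq EG xy.
have : x \in [set a; b] by rewrite -gab !inE eqxx.
have : y \in [set a; b] by rewrite -gab !inE eqxx orbT.
by rewrite !inE => /orP[]/eqP -> /orP[]/eqP ->; rewrite ?eqxx ?orbT.
Qed.

Section Sparse.
Variables (n : nat) (E : {set {set 'I_n}}).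
Hypothesis EG : E \in graphs n.
Implicit Types (u v w x y h : 'I_n).

Local Notation nbr := (nbr E).
Local Notation cnbr := (cnbr E).

Variable A : {set 'I_n}.
Hypothesis many : {in A, forall h, 4 <= #|special E A h|}.

(** Four special neighbours v of each h in A, with the next vertices [X h v] and [U h v] on a short
    path from v to A. If there is no such vertex, the default v adds nothing to [S]. *)
Let V h : {set 'I_n} := [set v in take 4 (enum (special E A h))].
Let X h v := odflt v [pick x | [&& adj E v x, x != h &
  (x \in A) || [exists u, [&& adj E x u, u != v & u \in cnbr A]]]].
Let U h v := odflt v [pick u | [&& adj E (X h v) u, u != v & u \in cnbr A]].
Let S := A :|: \bigcup_(h in A) \bigcup_(v in V h) [set v; X h v; U h v].
(** The final default does not occur on [S]: a vertex of [S] outside [cnbr A] is some [X h v],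
    adjacent to v, which lies in [S] and in [cnbr A]. Since parents in A are preferred, two steps
    always reach A. *)
Let par y :=
  if y \in A then y else
  if [pick h in A | adj E h y] is Some h then h else
  if [pick u in S | (u \in cnbr A) && adj E u y] is Some u then u else y.

Let V_special h v : v \in V h -> v \in special E A h.
Proof. by rewrite inE => /mem_take; rewrite mem_enum. Qed.

Let cardV h : h \in A -> #|V h| = 4.
Proof.
move=> hA; rewrite cardsE; have /card_uniqP -> := take_uniq 4 (enum_uniq (special E A h)).
rewrite size_take -cardE; have := many hA; rewrite leq_eqVlt => /orP[/eqP <-|->] //.
Qed.

Let AS y : y \in A -> y \in S.
Proof. by rewrite in_setU => ->. Qed.

Let VS h v : h \in A -> v \in V h -> [/\ v \in S, X h v \in S & U h v \in S].
Proof.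
move=> hA vV.
have sub : [set v; X h v; U h v] \subset S.
  by rewrite subsetU // (bigcup_max h) ?orbT // (bigcup_max v).
by split; apply: (subsetP sub); rewrite !inE eqxx ?orbT.
Qed.

Let V_adj h v : v \in V h -> adj E h v.
Proof. by move=> /V_special; rewrite inE in_nbr adjC => /andP[]. Qed.

Let V_cnbr h v : h \in A -> v \in V h -> v \in cnbr A.
Proof. by move=> hA /V_adj hv; apply/cnbrP; right; exists h. Qed.

Let XP h v : h \in A -> v \in V h -> v \notin A ->
  [/\ adj E v (X h v), X h v != h & X h v \in A \/
      [/\ adj E (X h v) (U h v), U h v != v & U h v \in cnbr A]].
Proof.
move=> hA /V_special; rewrite inE => /andP[_ /orP[->//|/existsP[x0 x0P]] _].
have XE : [&& adj E v (X h v), X h v != h & (X h v \in A) ||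
   [exists u, [&& adj E (X h v) u, u != v & u \in cnbr A]]].
  by rewrite /X; case: pickP => [x //|/(_ x0)]; rewrite x0P.
case/and3P: XE => vX Xh /orP cond; split=> //.
case: cond => [|/existsP[u0 u0P]]; [by left | right; apply/and3P].
by rewrite /U; case: pickP => [x //|/(_ u0)]; rewrite u0P.
Qed.

Let S_near y : y \in S -> y \in cnbr A \/
  exists u, [/\ u \in S, u \in cnbr A & adj E u y].
Proof.
rewrite in_setU => /orP[yA|/bigcupP[h hA /bigcupP[v vV]]].
  by left; apply/cnbrP; left.
have [vS XS US] := VS hA vV; have vc := V_cnbr hA vV.
rewrite 2!in_setU !in_set1 -orbA => /or3P[]/eqP ->; first by left.
- have [->|vX] : X h v = v \/ adj E v (X h v); [|by left|by right; exists v].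
  by rewrite /X; case: pickP => [x /and3P[]|_]; [right | left].
- by rewrite /U; case: pickP => [u /and3P[]|_]; left.
Qed.

Let par_id y : y \in A -> par y = y.
Proof. by rewrite /par => ->. Qed.

Let par_near y : y \in cnbr A -> par y \in A.
Proof.
rewrite /par; case: ifP => // yA /cnbrP[|[h hA hy]]; first by rewrite yA.
by case: pickP => [h' /andP[]//|/(_ h)]; rewrite hA hy.
Qed.

Let par_adj y : y \in S -> y \notin A -> adj E y (par y).
Proof.
move=> yS yA; rewrite /par (negPf yA); case: pickP => [h /andP[_]|noh].
  by rewrite adjC.
case: pickP => [u /and3P[_ _]|nou]; first by rewrite adjC.
case: (S_near yS) => [/cnbrP[|[h hA hy]]|[u [uS uc uy]]].
- by rewrite (negPf yA).
- by have := noh h; rewrite hA hy.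
- by have := nou u; rewrite uS uc uy.
Qed.

Let par_in y : y \in S -> par y \in S.
Proof.
move=> yS; rewrite /par; case: ifP => // _; case: pickP => [h /andP[hA _]|_].
  exact: AS.
by case: pickP => [u /and3P[]//|].
Qed.

Let par2 y : y \in S -> par (par y) \in A.
Proof.
move=> yS; case: (boolP (y \in cnbr A)) => yc; first by rewrite par_id par_near.
have yA : y \notin A by apply: contra yc => yA; apply/cnbrP; left.
case: (S_near yS) => [|[u [uS uc uy]]]; first by rewrite (negPf yc).
rewrite {2}/par (negPf yA); case: pickP => [h /andP[hA _]|_]; first by rewrite par_id.
by case: pickP => [u' /and3P[_ uc' _]|/(_ u)]; [exact: par_near | rewrite uS uc uy].
Qed.

Let NF := [set p in arcs E S | (p.2 != par p.1) && (p.1 != par p.2)].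
(* [par] is a forest of depth at most 2 rooted at A, and [NF] are the arcs outside
   it.  The walk h, v, X h v, U h v leaves the forest, and the first arc to do so
   determines h as the root of its tail and v as the child of h above the tail. *)
Let rec (p : 'I_n * 'I_n) :=
  if p.1 \in A then p else
  if par p.1 \in A then (par p.1, p.1) else (par (par p.1), par p.1).

Let rec_NF h v : h \in A -> v \in V h -> (h, v) \in rec @: NF.
Proof.
move=> hA vV; have [vS XS US] := VS hA vV; have hv := V_adj vV.
have hS := AS hA; have neq := adj_neq EG.
have inNF a b : a \in S -> b \in S -> adj E a b -> b != par a -> a != par b ->
    rec (a, b) = (h, v) -> (h, v) \in rec @: NF.
  by move=> aS bS ab ba ab' <-; apply: imset_f; rewrite inE /= ba ab' inE /= aS bS ab.
case: (eqVneq h (par v)) => [hpar|hpar]; last first.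
  apply: (inNF h v) => //; first by rewrite par_id // eq_sym neq.
  by rewrite /rec /= hA.
have vA : v \notin A.
  by apply/negP => vA; move: hpar (neq _ _ hv); rewrite par_id // => ->; rewrite eqxx.
have [vX Xh Xcond] := XP hA vV vA; set x := X h v in XS vX Xh Xcond.
case: (eqVneq v (par x)) => [xpar|xpar]; last first.
  apply: (inNF v x) => //; first by rewrite -hpar.
  by rewrite /rec /= (negPf vA) -hpar hA.
have xA : x \notin A.
  by apply/negP => xA; move: xpar (neq _ _ vX); rewrite par_id // => ->; rewrite eqxx.
case: Xcond => [|[xu uv uc]]; first by rewrite (negPf xA).
apply: (inNF x (U h v)) => //; first by rewrite -xpar.
(* x has depth 2 in the forest, so it cannot be the parent of [U h v], whose depth is at most 2. *)
- apply/eqP => xpar'; have := par2 US; rewrite -xpar' -xpar; exact/negP.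
- by rewrite /rec /= (negPf xA) -xpar (negPf vA) -hpar.
Qed.

(** The forest gives 2(#|S| - #|A|) arcs inside [S]. By [rec_NF] the four pairs (h, v) for each h in
    A come from distinct arcs outside the forest, which are therefore at least 4 #|A|. Halving the
    total gives #|S| + #|A| edges. *)
Lemma dense_of_special :
  exists S : {set 'I_n},
    [/\ A \subset S, #|S| <= 13 * #|A| & #|S| + #|A| <= #|induced E S|].
Proof.
exists S; split; first exact: subsetUl.
  apply: (@leq_trans (#|A| + 12 * #|A|)); last by rewrite -mulSn.
  apply: leq_trans (leq_card_setU _ _) _; rewrite leq_add2l.
  rewrite mulnC; apply: card_bigcup_le => h hA; rewrite -[12]/(4 * 3) -(cardV hA).
  apply: card_bigcup_le => v _; rewrite (leq_trans (leq_card_setU _ _)) //.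
  by rewrite cards1 addn1 ltnS cards2; case: (_ != _).
pose F1 := [set (y, par y) | y in S :\: A]; pose F2 := [set (par y, y) | y in S :\: A].
have cF1 : #|F1| = #|S| - #|A|.
  rewrite card_in_imset ?cardsD; last by move=> a b _ _ [].
  by have /setIidPr -> : A \subset S by exact: subsetUl.
have cF2 : #|F2| = #|S| - #|A|.
  rewrite card_in_imset ?cardsD; last by move=> a b _ _ [].
  by have /setIidPr -> : A \subset S by exact: subsetUl.
have cNF : 4 * #|A| <= #|NF|.
  pose P := [set p : 'I_n * 'I_n | (p.1 \in A) && (p.2 \in V p.1)].
  have -> : 4 * #|A| = #|P|.
    rewrite -[RHS]sum1_card (eq_bigl (fun p => (p.1 \in A) && (p.2 \in V p.1))); last first.
      by move=> p; rewrite inE.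
    rewrite -(pair_big_dep (mem A) (fun h v => v \in V h) (fun _ _ => 1)) /=.
    rewrite mulnC -sum_nat_const; apply: eq_bigr => h hA.
    by rewrite sum1_card cardV.
  apply: leq_trans (leq_imset_card rec NF); apply/subset_leq_card/subsetP => -[h v].
  by rewrite inE => /andP[/= hA vV]; apply: rec_NF.
have d12 : [disjoint F1 & F2].
  rewrite -setI_eq0; apply/eqP/setP => p; rewrite !inE; apply/negP.
  case/andP=> /imsetP[y /setDP[yS yA] ->] /imsetP[z /setDP[zS zA]] [yz zy].
  by have := par2 yS; rewrite zy -yz (negPf yA).
have d3 : [disjoint F1 :|: F2 & NF].
  rewrite -setI_eq0; apply/eqP/setP => p; rewrite in_setI in_setU [RHS]inE; apply/negP.
  case/andP=> /orP[]/imsetP[y _ ->]; rewrite inE /= eqxx ?andbF //=.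
have sub : F1 :|: F2 :|: NF \subset arcs E S.
  rewrite !subUset; apply/andP; split; last by apply/subsetP => p; rewrite inE => /andP[].
  apply/andP; split; apply/subsetP => p /imsetP[y /setDP[yS yA] ->];
    by rewrite inE /= yS par_in // 1?[adj E (par y) y]adjC par_adj.
have := subset_leq_card sub.
have cS : #|A| <= #|S| by apply: subset_leq_card; exact: subsetUl.
have := card_arcs_le S EG.
have -> : #|F1 :|: F2 :|: NF| = #|F1 :|: F2| + #|NF|.
  by apply/eqP; rewrite (leq_card_setU _ _).
have -> : #|F1 :|: F2| = #|F1| + #|F2| by apply/eqP; rewrite (leq_card_setU _ _).
rewrite cF1 cF2; move: cNF; clear -A.
move: #|NF| #|arcs E S| #|induced E S| #|S| => a b d e.
lia.
Qed.
End Sparse.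

(** * The value of the least number of colours *)

Lemma double_binS2 n : 2 * 'C(n.+1, 2) = n.+1 * n.
Proof. by rewrite -mul_bin_diag bin1. Qed.

(** The real number is the larger root of (x - 2)(x - 3) = 2D, and the two hypotheses place it
    between m - 1, excluded, and m. *)
Lemma is_ceil_of_bin (m D : nat) :
  D <= 'C(m - 2, 2) -> 'C(m - 3, 2) < D ->
  is_ceil m (Rdiv (Rplus (sqrt (Rplus (Rmult 8 (INR D)) 1)) 5) 2).
Proof.
move=> leD ltD.
(* The second hypothesis makes D positive, so [m - 2] and [m - 3] are not truncated. *)
have m4 : 4 <= m.
  rewrite leqNgt; apply/negP => lt4; suff : 'C(m - 2, 2) = 0 by lia.
  by apply: bin_small; lia.
have [a am] : exists a, m = a.+4 by exists (m - 4); lia.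
have e2 : m - 2 = a.+2 by lia.
have e3 : m - 3 = a.+1 by lia.
rewrite e2 in leD; rewrite e3 in ltD.
have {leD}/ssrnat.leP/le_INR leD : 2 * D <= a.+2 * a.+1 by rewrite -double_binS2 leq_mul2l.
have {ltD}/ssrnat.ltP/lt_INR ltD : a.+1 * a < 2 * D by rewrite -double_binS2 ltn_mul2l.
move: leD ltD; rewrite !mult_INR !S_INR /= /is_ceil am !S_INR.
have := pos_INR a; have := pos_INR D; move: (INR a) (INR D) => x y y0 x0 le_y lt_y.
have := sqrt_sqrt (8 * y + 1) ltac:(Lra.lra); have := sqrt_pos (8 * y + 1).
move: (sqrt _) => z z0 zz; split; Lra.nra.
Qed.

Section Tau.
Variables (n : nat) (E : {set {set 'I_n}}).
Hypothesis EG : E \in graphs n.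

Lemma max_degree_le_bin k : has_tone_coloring E 2 k -> max_degree E <= 'C(k - 2, 2).
Proof.
case=> f [f2 fP]; apply/bigmax_leqP => v _.
have disj u : adj E u v -> f u \subset ~: f v.
  move=> uv; have neq := adj_neq EG uv; rewrite -disjoints_subset -setI_eq0 -cards_eq0.
  apply: contraNT (fP u v neq); rewrite -lt0n; case: #|_| => //= i _.
  have w1 : within E 1 u v.
    by rewrite /= (negPf neq); apply/existsP; exists u; rewrite eqxx.
  by elim: i => //= i; move/orP => IH; apply/orP; left; apply/orP.
have <- : #|~: f v| = k - 2 by rewrite cardsCs setCK card_ord f2.
rewrite -cards_draws -(card_in_imset (f := f)).
  apply/subset_leq_card/subsetP => L /imsetP[u]; rewrite in_nbr => uv ->.
  by rewrite inE disj // f2 eqxx.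
move=> u w; rewrite !in_nbr => uv wv fuw; apply/eqP/negPn/negP => neq.
have := fP u w neq; rewrite fuw setIid f2 /= => /negP; apply.
apply/orP; right; apply/existsP; exists v; rewrite [adj E v w]adjC wv andbT.
by apply/orP; right; apply/existsP; exists u; rewrite eqxx.
Qed.

Variable s : nat.
Hypothesis s3 : 3 <= s.
Hypothesis sparse : forall S : {set 'I_n}, S != set0 ->
  #|S| <= 13 * #|[set v | s < #|nbr E v| ]| -> 13 * #|induced E S| < 14 * #|S|.
Hypothesis large : 'C(6 * s + 2, 2) <= max_degree E.

Lemma has_tone_coloring_sparse k :
  max_degree E <= 'C(k - 2, 2) -> has_tone_coloring E 2 k.
Proof.
move=> lek; apply: tonable_setT.
(* This is where the size of the maximum degree enters: 'C(k, 2) is then at least (3s + 1)k, which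
   pays for the greedy steps. *)
have k_ge : 6 * s + 4 <= k.
  rewrite leqNgt; apply/negP => ltk.
  have : 'C(k - 2, 2) <= 'C(6 * s + 1, 2) by apply: leq_bin2l; lia.
  have := double_binS2 (6 * s + 1); have := double_binS2 (6 * s).
  move: (leq_trans large lek); rewrite !addn1 !addn2; nia.
apply: (@tonable_peel _ _ EG k s [set v | s < #|nbr E v| ]).
- by move=> v; rewrite inE -leqNgt.
- move=> A AH A0; case: (boolP [exists h in A, #|special E A h| <= s]).
    by case/existsP=> h /andP[hA leh]; exists h.
  rewrite negb_exists => /forallP nos.
  have many : {in A, forall h, 4 <= #|special E A h|}.
    move=> h hA; have := nos h; rewrite hA /= -ltnNge; exact: leq_ltn_trans.
  have [S [AS leS geS]] := dense_of_special EG many.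
  have S0 : S != set0 by apply: contraNneq A0 => S0; rewrite -subset0 -S0.
  (* Sparsity gives 13(#|S| + #|A|) < 14 #|S|, so 13 #|A| < #|S|, against the size of [S]. *)
  have := sparse S0 (leq_trans leS _); rewrite leq_mul2l /= subset_leq_card //.
  move=> /(_ isT) lt14; exfalso; have A1 : 0 < #|A| by rewrite card_gt0.
  move: A1 leS geS lt14; move: #|A| #|S| #|induced E S|; lia.
- have [j kj] : exists j, k = j.+1 by exists k.-1; lia.
  rewrite kj in k_ge *; rewrite -(ltn_pmul2l (isT : 0 < 2)) double_binS2.
  have : (6 * s + 3) * j.+1 <= j * j.+1 by rewrite leq_mul2r; lia.
  have : s * s <= j.+1 * s by rewrite leq_mul2r; lia.
  lia.
- by move=> v; apply: leq_trans lek; exact: (leq_bigmax v).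
Qed.

Lemma is_tau_sparse : exists m : nat, is_tau E 2 m /\
  is_ceil m (Rdiv (Rplus (sqrt (Rplus (Rmult 8 (INR (max_degree E))) 1)) 5) 2).
Proof.
have ex : exists k, max_degree E <= 'C(k - 2, 2).
  exists (max_degree E).+3; case: (max_degree E) => [|d]; first by [].
  rewrite subSS -(@leq_pmul2l 2) // subSS subn0 double_binS2; nia.
case: (ex_minnP ex) => m lem minm; exists m; split.
  split=> [|k ltk /max_degree_le_bin/minm]; first exact: has_tone_coloring_sparse.
  by rewrite leqNgt ltk.
have pos : 0 < max_degree E.
  by apply: leq_trans large; rewrite bin_gt0; lia.
apply: is_ceil_of_bin => //; rewrite ltnNge; apply/negP.
case: m minm lem => [|m minm lem]; first by rewrite bin_small // leqNgt pos.
by rewrite subSS => /minm; rewrite ltnn.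
Qed.
End Tau.

(** * Random subsets *)

Section RandomSubset.
Local Open Scope ring_scope.
Variables (F : realFieldType) (T : finType) (X : {set T}) (p : F).
Implicit Types (E S : {set T}) (P Q : pred {set T}).

Definition wt E : F := p ^+ #|E| * (1 - p) ^+ (#|X| - #|E|).
Definition Pr P : F := \sum_(E in powerset X | P E) wt E.

Lemma wt_total (Y : {set T}) :
  \sum_(E in powerset Y) p ^+ #|E| * (1 - p) ^+ (#|Y| - #|E|) = 1 :> F.
Proof.
rewrite -[RHS](expr1n F #|Y|) -[in RHS](subrK p 1) exprDn.
have cardlt E : E \in powerset Y -> (#|E| < #|Y|.+1)%N.
  by rewrite inE ltnS; exact: subset_leq_card.
rewrite (partition_big (fun E => inord #|E| : 'I_#|Y|.+1) predT) //=.
apply: eq_bigr => i _; rewrite -(cards_draws Y i) -sumr_const; apply: eq_big => E.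
  rewrite !inE; case: (boolP (E \subset Y)) => //= EY; apply/eqP/eqP => [<-|Ei].
    by rewrite inordK // cardlt // inE.
  by apply: val_inj; rewrite /= inordK // cardlt // inE.
case/andP=> EY /eqP <-; rewrite mulrC inordK //; exact: cardlt.
Qed.

(** Adding [S] is a bijection from the subsets of [X :\: S] to the supersets of [S] in [X], and the
    weights of the former add up to 1. *)
Lemma Pr_superset S : S \subset X -> Pr (fun E => S \subset E) = p ^+ #|S|.
Proof.
move=> SX; rewrite /Pr -[RHS]mulr1 -(wt_total (X :\: S)) mulr_sumr.
rewrite (reindex_onto (fun E => S :|: E) (fun E => E :\: S)) /=; last first.
  by move=> E /andP[_ SE]; have := setID E S; rewrite (setIidPr SE).
apply: eq_big => E.
  rewrite !inE subUset SX subsetUl andbT /= subsetD.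
  case: (boolP (E \subset X)) => //= EX.
  by rewrite setDUl setDv set0U; apply/eqP/setDidPl.
case/andP=> _ /eqP; rewrite setDUl setDv set0U => /setDidPl dE.
have cU : #|S :|: E| = (#|S| + #|E|)%N.
  by apply/eqP; rewrite (leq_card_setU _ _) disjoint_sym.
rewrite /wt cU exprD cardsD (setIidPr SX) subnDA mulrA; congr (_ * _).
Qed.

Hypotheses (p0 : 0 <= p) (p1 : p <= 1).

Lemma wt_ge0 E : 0 <= wt E.
Proof. by rewrite mulr_ge0 ?exprn_ge0 // subr_ge0. Qed.

Lemma PrC P : Pr P = 1 - Pr (predC P).
Proof.
apply/eqP; rewrite eq_sym subr_eq eq_sym; apply/eqP.
by rewrite -(wt_total X) /Pr [RHS](bigID P).
Qed.

Lemma Pr_ge0 P : 0 <= Pr P.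
Proof. by apply: sumr_ge0 => E _; exact: wt_ge0. Qed.

Lemma Pr_le_sum (I : finType) (J : pred I) (Q : I -> pred {set T}) P :
  (forall E, E \subset X -> P E -> exists2 i, J i & Q i E) ->
  Pr P <= \sum_(i | J i) Pr (Q i).
Proof.
move=> cover; rewrite /Pr (exchange_big_dep (mem (powerset X))) /=; last first.
  by move=> i E _ /andP[].
rewrite big_mkcondr; apply: ler_sum => E EX.
have sum0 (K : pred I) : 0 <= \sum_(i | K i) wt E.
  by apply: sumr_ge0 => i _; exact: wt_ge0.
case: ifP => PE; last exact: sum0.
have [|i Ji QiE] := cover E _ PE; first by rewrite -powersetE.
by rewrite (bigD1 i) ?Ji ?EX //= lerDl.
Qed.

Lemma Pr_markov (Y : {set T} -> nat) P (a : nat) :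
  (forall E, E \subset X -> P E -> (a <= Y E)%N) ->
  Pr P * a%:R <= \sum_(E in powerset X) wt E * (Y E)%:R.
Proof.
move=> aY; rewrite /Pr mulr_suml big_mkcondr; apply: ler_sum => E EX.
case: ifP => PE; last by rewrite mulr_ge0 ?wt_ge0.
by rewrite ler_wpM2l ?wt_ge0 // ler_nat aY // -powersetE.
Qed.

End RandomSubset.

(** * Elementary bounds on powers and binomial coefficients *)

Section Estimates.

Lemma prod_nat_const_ord m a : \prod_(i < m) a = a ^ m.
Proof. by rewrite prod_nat_const card_ord. Qed.

(** A weak form of Stirling: the falling factorial of 2m of length m is at least m ^ m and equals
    'C(2m, m) m!, where 'C(2m, m) is at most 2 ^ (2m). *)
Lemma expn_self_le m : m ^ m <= 4 ^ m * m`!.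
Proof.
have le1 : m ^ m <= (m + m) ^_ m.
  rewrite -[m ^ m]prod_nat_const_ord ffact_prod; apply: leq_prod => i _.
  by have := ltn_ord i; lia.
apply: leq_trans le1 _; rewrite -bin_ffact leq_mul2r; apply/orP; right.
rewrite (_ : 4 = 2 ^ 2) // -expnM mul2n -addnn.
rewrite -[2]/(1 + 1) expnDn; under eq_bigr do rewrite !exp1n !muln1.
have ltm : m < (m + m).+1 by rewrite ltnS leq_addr.
by rewrite (bigD1 (Ordinal ltm)) //= leq_addr.
Qed.

Lemma expn_bin_le N m : m ^ m * 'C(N, m) <= 4 ^ m * N ^ m.
Proof.
apply: (@leq_trans (4 ^ m * m`! * 'C(N, m))); first by rewrite leq_mul2r expn_self_le orbT.
rewrite -mulnA leq_mul2l mulnC bin_ffact; apply/orP; right.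
rewrite ffact_prod -[N ^ m]prod_nat_const_ord.
by apply: leq_prod => i _; exact: leq_subr.
Qed.

Lemma expn_le_bin n K : 4 * K <= n -> n ^ K <= 2 ^ K * K`! * 'C(n - K, K).
Proof.
move=> le4; rewrite -mulnA [K`! * _]mulnC bin_ffact ffact_prod.
have -> : 2 ^ K * \prod_(i < K) (n - K - i) = \prod_(i < K) (2 * (n - K - i)).
  by rewrite big_split /= prod_nat_const card_ord.
rewrite -[n ^ K]prod_nat_const_ord; apply: leq_prod => i _.
by have := ltn_ord i; lia.
Qed.

End Estimates.

(** * Typical properties of sparse random graphs *)

Section FirstMoment.
Local Open Scope ring_scope.

(** The left side bounds the expected number of v-sets spanning v + j edges. The bounds (4n/v)^v and
    (4v)^(v+j) on the two binomials make it at most (16c)^v (4cv/n)^j. Writing 16c as 32c/2 and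
    using v/n <= 1/q and v <= 13j leaves 2^-v r^j with r the constant on the right, and r <= 1 gives
    r^j <= r. *)
Lemma first_moment_term (F : realFieldType) (n v j q : nat) (c p : F) :
  (0 < v)%N -> (0 < j)%N -> (0 < q)%N -> (v <= 13 * j)%N -> (v * q <= n)%N ->
  (1 <= c)%R -> (0 <= p)%R -> (p * n%:R <= c)%R ->
  (4 * c * (32 * c) ^+ 13 <= q%:R)%R ->
  ('C(n, v)%:R * ('C('C(v, 2), v + j)%:R * p ^+ (v + j)) <=
    4 * c * (32 * c) ^+ 13 / q%:R * 2^-1 ^+ v)%R.
Proof.
move=> v0 j0 q0 vj vq c1 p0 pn cq.
have vm0 m : (0 < v ^ m)%N by rewrite expn_gt0 v0.
have le1 : (v ^ v * 'C(n, v) <= 4 ^ v * n ^ v)%N := expn_bin_le n v.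
have le2 : ('C('C(v, 2), v + j) <= 4 ^ (v + j) * v ^ (v + j))%N.
  rewrite -(leq_pmul2l (vm0 (v + j)%N)).
  apply: (@leq_trans ((v + j) ^ (v + j) * 'C('C(v, 2), v + j))).
    by rewrite leq_mul2r leq_exp2r ?addn_gt0 ?v0 // leq_addr orbT.
  apply: leq_trans (expn_bin_le _ _) _; rewrite mulnCA leq_mul2l -expnMn; apply/orP; right.
  rewrite leq_exp2r ?addn_gt0 ?v0 //; case: (v) v0 => // w _.
  by rewrite -(leq_pmul2l (isT : 0 < 2)%N) -mul_bin_diag bin1; nia.
have n0 : (0 < n)%N by apply: leq_trans vq; rewrite muln_gt0 v0.
have qR : (0 < q%:R :> F)%R by rewrite ltr0n.
have nR : (0 < n%:R :> F)%R by rewrite ltr0n.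
have vR : (0 < v%:R :> F)%R by rewrite ltr0n.
set L := (_ * _); set r := 4 * c * (32 * c) ^+ 13 / q%:R.
have c0 : 0 <= c by rewrite (le_trans _ c1).
have L0 : 0 <= L by rewrite /L !mulr_ge0 ?exprn_ge0.
have r0 : 0 <= r by rewrite /r !mulr_ge0 ?exprn_ge0 ?invr_ge0 ?mulr_ge0.
have step1 : v%:R ^+ v * L <= 4 ^+ v * n%:R ^+ v * (4 ^+ (v + j) * v%:R ^+ (v + j)) * p ^+ (v + j).
  rewrite /L [X in X <= _]mulrA [X in X <= _]mulrA ler_wpM2r ?exprn_ge0 // ler_pM ?mulr_ge0 ?exprn_ge0 //.
    by rewrite -!natrX -!natrM ler_nat.
  by rewrite -!natrX -!natrM ler_nat.
have step2 : n%:R ^+ j * L <= (16 * c) ^+ v * (4 * c) ^+ j * v%:R ^+ j.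
  rewrite -(ler_pM2l (exprn_gt0 v vR)) -(ler_pM2l (exprn_gt0 v nR)).
  have -> : n%:R ^+ v * (v%:R ^+ v * (n%:R ^+ j * L)) = n%:R ^+ (v + j) * (v%:R ^+ v * L).
    by rewrite exprD; ring.
  apply: le_trans (_ : n%:R ^+ (v + j) * (4 ^+ v * n%:R ^+ v * (4 ^+ (v + j) * v%:R ^+ (v + j)) * p ^+ (v + j)) <= _).
    by rewrite ler_wpM2l ?exprn_ge0.
  have -> : n%:R ^+ (v + j) * (4 ^+ v * n%:R ^+ v * (4 ^+ (v + j) * v%:R ^+ (v + j)) * p ^+ (v + j))
     = (p * n%:R) ^+ (v + j) * (4 ^+ v * n%:R ^+ v * (4 ^+ (v + j) * v%:R ^+ (v + j))).
    by rewrite exprMn; ring.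
  apply: le_trans (_ : c ^+ (v + j) * (4 ^+ v * n%:R ^+ v * (4 ^+ (v + j) * v%:R ^+ (v + j))) <= _).
    rewrite ler_wpM2r ?mulr_ge0 ?exprn_ge0 //.
    by apply: lerXn2r => //; rewrite ?nnegrE ?mulr_ge0.
  rewrite le_eqVlt; apply/orP; left; apply/eqP.
  rewrite (_ : 16 = 4 * 4); last by ring.
  by rewrite !exprMn !exprD; ring.
have step3 : q%:R ^+ j * L <= (16 * c) ^+ v * (4 * c) ^+ j.
  rewrite -(ler_pM2r (exprn_gt0 j vR)); apply: le_trans step2.
  rewrite mulrAC -exprMn ler_wpM2r // lerXn2r ?nnegrE ?mulr_ge0 //.
  by rewrite -natrM ler_nat mulnC.
have step4 : (16 * c) ^+ v <= 2^-1 ^+ v * (32 * c) ^+ (13 * j).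
  have -> : 16 * c = 2^-1 * (32 * c) by field.
  by rewrite exprMn ler_wpM2l ?exprn_ge0 ?invr_ge0 // ler_weXn2l //; lra.
have step5 : L <= r ^+ j * 2^-1 ^+ v.
  rewrite -(ler_pM2l (exprn_gt0 j qR)); apply: (le_trans step3).
  have -> : r ^+ j = (4 * c) ^+ j * (32 * c) ^+ (13 * j) / q%:R ^+ j.
    by rewrite /r expr_div_n exprMn -exprM.
  have -> : q%:R ^+ j * ((4 * c) ^+ j * (32 * c) ^+ (13 * j) / q%:R ^+ j * 2^-1 ^+ v)
     = 2^-1 ^+ v * (32 * c) ^+ (13 * j) * (4 * c) ^+ j.
    by field; rewrite expf_neq0 // gt_eqF.
  by rewrite ler_wpM2r // exprn_ge0 // mulr_ge0.
apply: (le_trans step5); rewrite ler_wpM2r ?exprn_ge0 ?invr_ge0 //.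
have r1 : r <= 1 by rewrite /r ler_pdivrMr // mul1r.
by case: (j) j0 => // i _; rewrite exprS ler_piMr // exprn_ile1.
Qed.
End FirstMoment.

Definition dense_on n (M : nat) (E : {set {set 'I_n}}) : bool :=
  [exists S : {set 'I_n}, [&& S != set0, #|S| <= M & 14 * #|S| <= 13 * #|induced E S|]].

Section Gnp.
Local Open Scope ring_scope.
Variables (F : realFieldType) (n : nat) (p : F).
Hypotheses (p0 : 0 <= p) (p1 : p <= 1).
Local Notation Pr := (Pr (pairs n) p).
Local Notation wt := (wt (pairs n) p).

Lemma sum_half_pow M : \sum_(v < M) (2^-1 : F) ^+ v.+1 <= 1.
Proof.
suff -> : \sum_(v < M) (2^-1 : F) ^+ v.+1 = 1 - 2^-1 ^+ M.
  by rewrite gerBl exprn_ge0 // invr_ge0.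
elim: M => [|M IH]; first by rewrite big_ord0 expr0 subrr.
by rewrite big_ord_recr /= IH exprS; field.
Qed.

(** Union bound over the nonempty sets [S] and the sets of [m #|S|] pairs inside [S]; the index v
    stands for size v.+1. *)
Lemma Pr_dense_on_le_sum (M : nat) (m : nat -> nat) :
  (forall v e, 14 * v <= 13 * e -> m v <= e)%N ->
  Pr (dense_on M) <=
    \sum_(v < M) 'C(n, v.+1)%:R * ('C('C(v.+1, 2), m v.+1)%:R * p ^+ m v.+1).
Proof.
move=> mP.
pose inside (S : {set 'I_n}) := [set e : {set 'I_n} | e \subset S & #|e| == 2].
pose sizes (S : {set 'I_n}) := (S != set0) && (#|S| <= M)%N.
pose J (q : {set 'I_n} * {set {set 'I_n}}) :=
  sizes q.1 && (q.2 \in [set A : {set {set 'I_n}} | A \subset inside q.1 & #|A| == m #|q.1|]).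
apply: le_trans (_ : \sum_(q | J q) Pr (fun E => q.2 \subset E) <= _).
  apply: Pr_le_sum => // E EG /existsP[S /and3P[S0 leM leS]].
  have : (0 < 'C(#|induced E S|, m #|S|))%N by rewrite bin_gt0 mP.
  rewrite -cards_draws => /card_gt0P[A]; rewrite inE => /andP[AE cA].
  exists (S, A); last by apply: subset_trans AE _; apply/subsetP => e; rewrite inE => /andP[].
  rewrite /J /sizes /= S0 leM inE cA /= andbT.
  apply/subsetP => e /(subsetP AE); rewrite !inE => /andP[eE ->].
  by have := subsetP EG e eE; rewrite inE.
rewrite -(pair_big_dep sizes (fun S A => A \in [set A : {set {set 'I_n}} | A \subset inside S & #|A| == m #|S|])
  (fun S A => Pr (fun E => A \subset E))) /=.
apply: le_trans (_ : \sum_(S | sizes S) 'C('C(#|S|, 2), m #|S|)%:R * p ^+ m #|S| <= _).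
  apply: ler_sum => S _; rewrite mulr_natl -[X in 'C(X, _)](cards_draws S 2) -cards_draws -sumr_const.
  apply: ler_sum => A; rewrite inE => /andP[Asub /eqP <-].
  rewrite Pr_superset //; apply: subset_trans Asub _; apply/subsetP => e.
  by rewrite !inE => /andP[].
have sizeP S : sizes S -> (#|S|.-1 < M)%N /\ #|S|.-1.+1 = #|S|.
  by case/andP; rewrite -card_gt0 => /prednK -> ->.
rewrite {}/J {}/sizes in sizeP *; case: (M) sizeP => [|M'] sizeP.
  by rewrite big_ord0 big1 // => S /sizeP[].
rewrite (partition_big (fun S : {set 'I_n} => inord #|S|.-1 : 'I_M'.+1) predT) //=.
apply: ler_sum => v _.
have -> : 'C(n, v.+1) = #|[set A : {set 'I_n} | A \subset setT & #|A| == v.+1]|.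
  by rewrite cards_draws cardsT card_ord.
rewrite mulr_natl -sumr_const.
rewrite [X in X <= _]big_mkcond [X in _ <= X]big_mkcond; apply: ler_sum => S _.
case: ifP => [/andP[sS /eqP vS]|_].
  have [lt eqS] := sizeP S sS.
  have vE : #|S| = v.+1 by rewrite -vS inordK.
  by rewrite inE subsetT vE eqxx.
by case: ifP => // _; rewrite mulr_ge0 // exprn_ge0.
Qed.

Lemma Pr_dense_on_le (M q : nat) (c : F) :
  (0 < q)%N -> (M * q <= n)%N -> 1 <= c -> p * n%:R <= c ->
  4 * c * (32 * c) ^+ 13 <= q%:R ->
  Pr (dense_on M) <= 4 * c * (32 * c) ^+ 13 / q%:R.
Proof.
(* [m v] is v plus v/13 rounded up, the least number of edges of a dense set of size v. Thus j is
   v/13 rounded up, and v <= 13j. *)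
move=> q0 Mq c1 pn cq; pose m v := (v + (v + 12) %/ 13)%N.
apply: le_trans (Pr_dense_on_le_sum M (m := m) _) _; first by rewrite /m; lia.
apply: le_trans (_ : \sum_(v < M) 4 * c * (32 * c) ^+ 13 / q%:R * 2^-1 ^+ v.+1 <= _).
  apply: ler_sum => v _; apply: first_moment_term => //; first by lia.
    by lia.
  by apply: leq_trans Mq; rewrite leq_mul2r ltn_ord orbT.
rewrite -mulr_sumr ler_piMr ?sum_half_pow //.
by rewrite !mulr_ge0 ?invr_ge0 ?exprn_ge0 ?mulr_ge0 // (le_trans _ c1).
Qed.

Lemma Pr_adj (u v : 'I_n) : Pr (fun E => adj E u v) <= p.
Proof.
case: (eqVneq u v) => [->|uv].
  rewrite /Pr big_pred0 // => E; apply/negP => /andP[EG].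
  by rewrite (adjxx EG).
have sub : [set [set u; v]] \subset pairs n by rewrite sub1set inE cards2 uv.
apply: le_trans (_ : Pr (fun E => [set [set u; v]] \subset E) <= _); last first.
  by rewrite Pr_superset // cards1 expr1.
rewrite /Pr le_eqVlt; apply/orP; left; apply/eqP.
by apply: eq_bigl => E; rewrite sub1set.
Qed.

(** Markov's inequality for the number of ordered adjacent pairs: its mean is at most n^2 p, and it
    is at least s times the number of high vertices. *)
Lemma Pr_many_high_le (M s : nat) :
  Pr (fun E => (M < 13 * #|[set v | (s < #|nbr E v|)%N]|)%N) * (M * s)%:R
   <= 13 * (n%:R ^+ 2 * p).
Proof.
apply: le_trans (_ : \sum_(E in powerset (pairs n)) wt E * (13 * #|[set q : 'I_n * 'I_n | adj E q.1 q.2]|)%:R <= _).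
  apply: Pr_markov => // E EG ltM.
  set H := [set v | _] in ltM.
  have leH : (#|H| * s <= #|[set q : 'I_n * 'I_n | adj E q.1 q.2]|)%N.
    rewrite -sum_nat_const -[X in (_ <= X)%N]sum1_card.
    rewrite (eq_bigl (fun q => predT q.1 && adj E q.1 q.2)); last by move=> q; rewrite inE.
    rewrite -(pair_big_dep predT (fun u v => adj E u v) (fun _ _ => 1%N)) /=.
    rewrite big_mkcond; apply: leq_sum => v _; case: ifP => //; rewrite inE => /ltnW le.
    rewrite sum1_card; apply: leq_trans le _.
    by apply/subset_leq_card/subsetP => u; rewrite in_nbr adjC.
  by have := ltnW ltM; nia.
under eq_bigr => E _ do rewrite natrM mulrCA -sum1_card natr_sum.
rewrite -mulr_sumr ler_wpM2l //.
under eq_bigr => E _ do rewrite mulr_sumr.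
rewrite (exchange_big_dep predT) //=.
apply: le_trans (_ : \sum_(q : 'I_n * 'I_n) p <= _).
  apply: ler_sum => -[u v] _; apply: le_trans (Pr_adj u v); rewrite /Pr.
  rewrite le_eqVlt; apply/orP; left; apply/eqP.
  by apply: eq_big => [E|E _]; [rewrite [(u, v) \in _]inE | rewrite mulr1].
by rewrite sumr_const card_prod card_ord -[X in X <= _]mulr_natl natrM expr2.
Qed.
End Gnp.

(** * Lower tail of the maximum degree by switching stars *)

Section Star.
Variable n : nat.
Implicit Types (u v : 'I_n) (A : {set 'I_n}) (E : {set {set 'I_n}}).

Definition star v A : {set {set 'I_n}} := [set [set v; u] | u in A].

Lemma set2_eqP u v w : u != v -> [set v; u] = [set v; w] -> u = w.
Proof.
move=> uv e; have : u \in [set v; w] by rewrite -e !inE eqxx orbT.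
by rewrite !inE (negPf uv) => /eqP.
Qed.

Lemma star_pairs v A : v \notin A -> star v A \subset pairs n.
Proof.
move=> vA; apply/subsetP => e /imsetP[u uA ->]; rewrite inE cards2.
suff -> : v != u by []; by apply: contraNneq vA => ->.
Qed.

Lemma card_star v A : v \notin A -> #|star v A| = #|A|.
Proof.
move=> vA; apply: card_in_imset => u w uA _; apply: set2_eqP.
by apply: contraNneq vA => <-.
Qed.

Lemma star_subset v A E : (star v A \subset E) = (A \subset nbr E v).
Proof.
apply/subsetP/subsetP => [sub u uA|sub e /imsetP[u uA ->]].
  by rewrite in_nbr adjC; apply: sub; apply: imset_f.
by have := sub u uA; rewrite in_nbr adjC.
Qed.

Lemma card_nbr_max E v : #|nbr E v| <= max_degree E.
Proof. exact: (leq_bigmax v). Qed.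

Lemma card_addable_stars E K v : E \in graphs n -> max_degree E < K ->
  'C(n - K, K) <=
    #|[set A : {set 'I_n} | [&& v \notin A, #|A| == K & [disjoint star v A & E]]]|.
Proof.
move=> EG ltK; pose W := ~: (v |: nbr E v).
have cW : n - K <= #|W|.
  rewrite -{1}(card_ord n) -(cardsC (v |: nbr E v)) leq_subLR leq_add2r cardsU1.
  by apply: leq_trans (leq_add (leq_b1 _) (card_nbr_max E v)) _; rewrite add1n.
apply: leq_trans (leq_bin2l _ cW) _; rewrite -cards_draws.
apply/subset_leq_card/subsetP => A; rewrite !inE => /andP[/subsetP AW ->] /=.
apply/andP; split; first by apply/negP => /AW; rewrite !inE eqxx.
rewrite disjoint_subset; apply/subsetP => e /imsetP[u /AW uW ->].
by move: uW; rewrite !inE negb_or => /andP[_]; rewrite adjC.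
Qed.

(** Fix one removable star. Its removal lowers only the degrees of its K + 1 vertices, so every
    vertex of degree at least K, in particular the centre of any removable star, is among them. Such
    a centre has degree at most 2K, so its leaves form one of at most 4 ^ K subsets of its
    neighbourhood. *)
Lemma card_removable_stars E K : E \in graphs n ->
  #|[set q : 'I_n * {set 'I_n} | [&& q.1 \notin q.2, #|q.2| == K,
      star q.1 q.2 \subset E & max_degree (E :\: star q.1 q.2) < K]]| <= K.+1 * 4 ^ K.
Proof.
move=> EG; set B := [set q | _].
have [->|[[v0 A0]]] := set_0Vmem B; first by rewrite cards0.
rewrite inE /= => /and4P[v0A0 /eqP cA0 _ lt0].
pose blk v := if #|nbr E v| <= K + K then setX [set v] (powerset (nbr E v)) else set0.
apply: (@leq_trans #|\bigcup_(v in v0 |: A0) blk v|); last first.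
  rewrite -cA0 -[_.+1]/(true + _) -v0A0 -cardsU1; apply: card_bigcup_le => v _.
  rewrite /blk; case: ifP => [le|_]; last by rewrite cards0.
  by rewrite cardsX cards1 mul1n card_powerset -[4]/(2 ^ 2) -expnM mul2n -addnn leq_exp2l ?cA0.
apply/subset_leq_card/subsetP => -[v A]; rewrite inE /= => /and4P[vA /eqP cA sub lt1].
have Anbr : A \subset nbr E v by rewrite -star_subset.
apply/bigcupP; exists v.
  rewrite in_setU1; apply: contraLR lt0; rewrite negb_or -leqNgt => /andP[vv0 vA0].
  apply: leq_trans (card_nbr_max _ v); rewrite -cA; apply: leq_trans (subset_leq_card Anbr) _.
  apply/subset_leq_card/subsetP => u; rewrite !in_nbr /adj in_setD => ->; rewrite andbT.
  apply/negP => /imsetP[a aA0 e]; have : v \in [set v0; a] by rewrite -e !inE eqxx orbT.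
  by rewrite !inE (negPf vv0) /= => /eqP va; rewrite va aA0 in vA0.
have le : #|nbr E v| <= K + K.
  apply: (@leq_trans #|nbr (E :\: star v A) v :|: A|).
    apply/subset_leq_card/subsetP => u; rewrite in_setU !in_nbr => uv.
    rewrite /adj in_setD [_ \in E]uv andbT; case: (boolP (_ \in star v A)) => //= /imsetP[a aA e].
    rewrite (set2_eqP (adj_neq EG uv) (w := a)) //; by rewrite setUC.
  rewrite (leq_trans (leq_card_setU _ _)) // cA leq_add2r.
  exact: leq_trans (card_nbr_max _ _) (ltnW lt1).
by rewrite /blk le !inE eqxx.
Qed.
End Star.

Section LowDegree.
Local Open Scope ring_scope.
Variables (F : realFieldType) (n : nat) (p : F).
Hypotheses (p0 : 0 <= p) (p1 : p <= 1).
Local Notation Pr := (Pr (pairs n) p).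
Local Notation wt := (wt (pairs n) p).

(** Passing from [E] to [E :|: S] multiplies the weight by p ^ #|S| and drops factors 1 - p, which
    are at most 1. *)
Lemma wt_add (E S : {set {set 'I_n}}) : [disjoint S & E] ->
  wt E * p ^+ #|S| <= wt (E :|: S).
Proof.
move=> dis; have cU : #|E :|: S| = (#|E| + #|S|)%N.
  by apply/eqP; rewrite (leq_card_setU _ _) disjoint_sym.
rewrite /wt cU exprD mulrAC ler_wpM2l ?mulr_ge0 ?exprn_ge0 //.
by apply: ler_wiXn2l; rewrite ?subr_ge0 ?gerBl // leq_sub2l // leq_addr.
Qed.

(* Adding a K-star to a graph of maximum degree below K can be done in at least
   n * 'C(n - K, K) ways, while few K-stars of a graph can be removed so as to
   bring the maximum degree below K. *)
Lemma Pr_max_degree_lt K :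
  Pr (fun E => (max_degree E < K)%N) * ((n * 'C(n - K, K))%:R * p ^+ K)
    <= (K.+1 * 4 ^ K)%:R.
Proof.
pose ok (q : 'I_n * {set 'I_n}) := (q.1 \notin q.2) && (#|q.2| == K).
pose st (q : 'I_n * {set 'I_n}) := star q.1 q.2.
apply: le_trans (_ : \sum_(E in powerset (pairs n) | (max_degree E < K)%N)
   \sum_(q | ok q && [disjoint st q & E]) wt (E :|: st q) <= _).
  rewrite /Pr mulr_suml; apply: ler_sum => E /andP[EG ltK].
  apply: le_trans (_ : \sum_(q | ok q && [disjoint st q & E]) wt E * p ^+ K <= _).
    have wp0 : 0 <= wt E * p ^+ K by rewrite mulr_ge0 ?exprn_ge0 //; exact: wt_ge0.
    rewrite sumr_const -[X in _ <= X]mulr_natl mulrCA ler_wpM2r // ler_nat.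
    have -> : (n * 'C(n - K, K) = \sum_(v : 'I_n) 'C(n - K, K))%N.
      by rewrite sum_nat_const card_ord.
    rewrite -[X in (_ <= X)%N]sum1_card.
    rewrite (eq_bigl (fun q : 'I_n * {set 'I_n} => predT q.1 &&
       [&& q.1 \notin q.2, #|q.2| == K & [disjoint star q.1 q.2 & E]])); last first.
      by move=> q; rewrite unfold_in /ok -andbA.
    rewrite -(pair_big_dep predT (fun v (A : {set 'I_n}) =>
      [&& v \notin A, #|A| == K & [disjoint star v A & E]]) (fun _ _ => 1%N)) /=.
    apply: leq_sum => v _; apply: leq_trans (card_addable_stars v EG ltK) _.
    by rewrite -sum1_card; apply/eq_leq/eq_bigl => A; rewrite inE.
  apply: ler_sum => q /andP[/andP[vA /eqP cA] dis].
  by rewrite -cA -(card_star vA) wt_add.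
rewrite (exchange_big_dep ok) /=; last by move=> E q _ /andP[].
apply: le_trans (_ : \sum_(q | ok q) \sum_(E in powerset (pairs n) |
    (st q \subset E) && (max_degree (E :\: st q) < K)%N) wt E <= _).
  apply: ler_sum => q okq; have [vA _] := andP okq; rewrite le_eqVlt; apply/orP; left; apply/eqP.
  rewrite [RHS](reindex_onto (fun E => E :|: st q) (fun E => E :\: st q)) /=; last first.
    by move=> E /and3P[_ sub _]; have := setID E (st q); rewrite (setIidPr sub) setUC.
  apply: eq_bigl => E; rewrite !inE subUset star_pairs // subsetUr andbT /=.
  rewrite setDUl setDv setU0; case: (boolP (E \subset _)) => //= _.
  rewrite disjoint_sym; apply/idP/idP => [/and3P[lt _ /setDidPl ->]|].
    by rewrite lt eqxx.
  case/andP=> lt /eqP dE; move: lt; rewrite dE => ->; move/setDidPl: dE => ->.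
  by rewrite andbT okq.
rewrite (exchange_big_dep (mem (powerset (pairs n)))) /=; last by move=> q E _ /andP[].
apply: le_trans (_ : \sum_(E in powerset (pairs n)) (K.+1 * 4 ^ K)%:R * wt E <= _);
  last by rewrite -mulr_sumr wt_total mulr1.
apply: ler_sum => E EG; rewrite sumr_const -[X in X <= _]mulr_natl.
apply: ler_wpM2r; [exact: wt_ge0 | rewrite ler_nat].
apply: leq_trans (card_removable_stars K EG).
apply/subset_leq_card/subsetP => q; rewrite unfold_in inE /ok => /andP[/andP[-> ->] /andP[_]].
by [].
Qed.

(** For constant K the right side does not depend on n, so the probability is O(1/n). The factor 8 ^
    K collects 4 ^ K from the removable stars and 2 ^ K from [expn_le_bin]. *)
Lemma Pr_max_degree_lt_le K (c : F) : (4 * K <= n)%N -> 0 < c -> p * n%:R = c ->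
  Pr (fun E => (max_degree E < K)%N) * n%:R <= (K.+1 * 8 ^ K * K`!)%:R / c ^+ K.
Proof.
move=> le4 c0 pn; set Z := Pr _.
have Z0 : 0 <= Z by exact: Pr_ge0.
rewrite ler_pdivlMr ?exprn_gt0 // -pn exprMn.
have leN : n%:R ^+ K <= (2 ^ K * K`!)%:R * 'C(n - K, K)%:R :> F.
  by rewrite -natrX -natrM ler_nat expn_le_bin.
have -> : Z * n%:R * (p ^+ K * n%:R ^+ K) = (Z * n%:R * p ^+ K) * n%:R ^+ K by ring.
apply: le_trans (ler_wpM2l _ leN) _; first by rewrite !mulr_ge0 ?exprn_ge0.
have -> : Z * n%:R * p ^+ K * ((2 ^ K * K`!)%:R * 'C(n - K, K)%:R)
   = (2 ^ K * K`!)%:R * (Z * ((n * 'C(n - K, K))%:R * p ^+ K)) by rewrite !natrM; ring.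
apply: le_trans (ler_wpM2l (ler0n _ _) (Pr_max_degree_lt K)) _.
rewrite -natrM ler_nat (_ : 8 = 2 * 4)%N // expnMn; lia.
Qed.
End LowDegree.

(** * Choice of the constants and passage to the limit *)

Definition sparse_high n (s : nat) (E : {set {set 'I_n}}) : bool :=
  ('C(6 * s + 2, 2) <= max_degree E) &&
  ~~ dense_on (13 * #|[set v | s < #|nbr E v| ]|) E.

Section Asymptotics.
Local Open Scope ring_scope.
Variables (F : archiRealFieldType).

(** The constants are chosen in the order q, s, K, N. With M = n/q rounded down, a large q makes
    dense sets of size at most M unlikely, a large s keeps 13 times the number of high vertices
    below M, and a large n pushes the maximum degree to K; each failure has probability at most
    eps/4. That s depends on eps is harmless, since the conclusion of [is_tau_sparse] does not
    mention s. *)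
Lemma Pr_sparse_high (c eps : F) : 0 < c -> 0 < eps ->
  exists2 s : nat, (3 <= s)%N & exists N : nat, forall (n : nat) (p : F),
    (N <= n)%N -> p * n%:R = c ->
    [/\ 0 <= p, p <= 1 & 1 - eps < Pr (pairs n) p (sparse_high s)].
Proof.
move=> c0 eps0.
have nat_above (x : F) : exists a : nat, x <= a%:R.
  exists (Num.bound `|x|); rewrite (le_trans (ler_norm x)) // ltW //.
  exact: archi_boundP.
(* [first_moment_term] asks for a constant at least 1. *)
pose c1 := c + 1; pose b := 4 * c1 * (32 * c1) ^+ 13.
have c11 : 1 <= c1 by rewrite /c1; lra.
have b0 : 0 < b by rewrite /b !mulr_gt0 ?exprn_gt0 ?mulr_gt0 //; lra.
have [q qP] := nat_above (b + 4 * b / eps).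
have be0 : 0 < 4 * b / eps by apply: divr_gt0 eps0; apply: mulr_gt0 b0; rewrite ltr0n.
have qb : b <= q%:R by rewrite (le_trans _ qP) // lerDl ltW.
have qbe : 4 * b / eps <= q%:R by rewrite (le_trans _ qP) // lerDr ltW.
have q0 : 0 < q%:R :> F by exact: lt_le_trans qb.
have q0N : (0 < q)%N by rewrite -(ltr0n F).
(* The Markov bound is 13nc/(Ms) with n <= 2Mq, thus at most 26qc/s, which is at most eps/4 for this
   s. *)
have [s0 s0P] := nat_above (104 * q%:R * c / eps).
pose s := (s0 + 3)%N; exists s; first by rewrite leq_addl.
have [K KE] : exists K, K = 'C(6 * s + 2, 2) by exists 'C(6 * s + 2, 2).
pose C : F := (K.+1 * 8 ^ K * K`!)%:R / c ^+ K.
have [n1 n1P] := nat_above c; have [n2 n2P] := nat_above (4 * C / eps).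
exists (n1 + n2 + q + 4 * K + 1)%N => n p leN pn.
have [n1n n2n qn Kn] : [/\ n1 <= n, n2 <= n, q < n & 4 * K <= n]%N by move: leN; clear; split; lia.
have n0 : 0 < n%:R :> F by rewrite ltr0n; exact: leq_ltn_trans qn.
have leR (m : nat) : (m <= n)%N -> m%:R <= n%:R :> F by rewrite ler_nat.
have p0 : 0 <= p by rewrite -(pmulr_lge0 _ n0) pn ltW.
have p1 : p <= 1.
  by rewrite -(ler_pM2r n0) pn mul1r (le_trans n1P) // leR.
split=> //; pose M := (n %/ q)%N.
have Mq : (M * q <= n)%N by exact: leq_trunc_div.
have nM : n%:R <= 2 * M%:R * q%:R :> F.
  rewrite -!natrM ler_nat; have := ltn_ceil n q0N.
  have : (1 <= M)%N by rewrite divn_gt0 // ltnW.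
  by rewrite -/M; move: (M); clear; nia.
pose high E := [set v | (s < #|nbr E v|)%N] : {set 'I_n}.
have bad1 : Pr (pairs n) p (dense_on M) <= eps / 4.
  apply: le_trans (Pr_dense_on_le p0 p1 (q := q) (c := c1) q0N Mq c11 _ _) _.
  - by rewrite pn /c1; lra.
  - exact: qb.
  - rewrite -/b ler_pdivrMr // mulrAC ler_pdivlMr //.
    by move: qbe; rewrite ler_pdivrMr //; lra.
have bad2 : Pr (pairs n) p (fun E => (M < 13 * #|high E|)%N) <= eps / 4.
  have : Pr (pairs n) p (fun E => (M < 13 * #|high E|)%N) * (M * s)%:R
    <= 13 * (n%:R ^+ 2 * p) := Pr_many_high_le n p0 p1 M s.
  set P2 := Pr _ _ _; rewrite expr2 -mulrA [n%:R * p]mulrC pn natrM => le2.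
  have P20 : 0 <= P2 by exact: Pr_ge0.
  have sR : 104 * q%:R * c / eps <= s%:R by rewrite (le_trans s0P) // ler_nat leq_addr.
  rewrite ler_pdivrMr // in sR.
  have M0 : 0 < M%:R :> F.
    by rewrite ltr0n divn_gt0 // ltnW.
  have s0' : 0 < s%:R :> F by rewrite ltr0n /s addn3.
  rewrite -(ler_pM2r (mulr_gt0 M0 s0')) (le_trans le2) //.
  apply: le_trans (_ : 26 * c * (M%:R * q%:R) <= _).
    have -> : 26 * c * (M%:R * q%:R) = 13 * c * (2 * M%:R * q%:R) by ring.
    have -> : 13 * (n%:R * c) = 13 * c * n%:R by ring.
    by rewrite ler_wpM2l // mulr_ge0 // ltW.
  have -> : 26 * c * (M%:R * q%:R) = M%:R / 4 * (104 * q%:R * c) by field.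
  have -> : eps / 4 * (M%:R * s%:R) = M%:R / 4 * (s%:R * eps) by field.
  by rewrite ler_wpM2l // divr_ge0.
have bad3 : Pr (pairs n) p (fun E => (max_degree E < K)%N) <= eps / 4.
  have := Pr_max_degree_lt_le p0 p1 Kn c0 pn; rewrite -/C => le3.
  have CP : 4 * C / eps <= n%:R by rewrite (le_trans n2P) // leR.
  rewrite ler_pdivrMr // in CP.
  by rewrite -(ler_pM2r n0) (le_trans le3) //; lra.
pose bad (i : 'I_3) : pred {set {set 'I_n}} := match val i with
  | 0 => dense_on M
  | 1 => fun E => (M < 13 * #|high E|)%N
  | _ => fun E => (max_degree E < K)%N
  end.
rewrite PrC ltrD2l ltrN2.
apply: le_lt_trans (_ : \sum_(i < 3) Pr (pairs n) p (bad i) < _); last first.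
  rewrite !big_ord_recl big_ord0 /bad /=; lra.
apply: Pr_le_sum => // E _; rewrite /= negb_and negbK -ltnNge => /orP[ltK|dense].
  by exists (inord 2) => //; rewrite /bad /= inordK // KE.
have [leM|ltM] := leqP (13 * #|high E|) M; last first.
  by exists (inord 1) => //; rewrite /bad /= inordK.
exists ord0 => //; case/existsP: dense => S /and3P[S0 leS dS].
by apply/existsP; exists S; rewrite S0 (leq_trans leS leM).
Qed.
End Asymptotics.

(** [P] is an arbitrary proposition, so its probability is only sandwiched, between that of a
    decidable event implying [P] and the total mass 1. *)
Lemma gnp_prob_bounds n (p : R) (P : {set {set 'I_n}} -> Prop) (good : pred {set {set 'I_n}}) :
  (0 <= p)%R -> (p <= 1)%R -> (forall E, E \in graphs n -> good E -> P E) ->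
  (Pr (pairs n) p good <= gnp_prob n p P)%R /\ (gnp_prob n p P <= 1)%R.
Proof.
move=> p0 p1 goodP.
have wE E : gnp_weight n p E = wt (pairs n) p E by rewrite /gnp_weight !RpowE.
have w0 E : (0 <= wt (pairs n) p E)%R by exact: wt_ge0.
rewrite /gnp_prob -(wt_total p (pairs n)) /Pr big_mkcondr; split.
  apply: ler_sum => E EG; rewrite wE.
  case: ifP => gE; case: ClassicalEpsilon.excluded_middle_informative => [_|nP] /=.
  - exact: lexx.
  - by case: nP; exact: goodP.
  - exact: w0.
  - exact: lexx.
apply: ler_sum => E EG; rewrite wE.
by case: ClassicalEpsilon.excluded_middle_informative => [_|_] /=; [exact: lexx | exact: w0].
Qed.

Theorem theorem2 (c : R) (hc : Rlt 0 c) :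
  Un_cv (fun n : nat =>
           gnp_prob n (Rdiv c (INR n))
             (fun E => exists m : nat,
                 is_tau E 2 m /\
                 is_ceil m (Rdiv (Rplus (sqrt (Rplus (Rmult 8 (INR (max_degree E))) 1)) 5) 2)))
        1.
Proof.
move=> eps /RltP eps0; move/RltP: hc => c0.
have [s s3 [N NP]] := Pr_sparse_high c0 eps0.
(* The successor keeps n positive, so that c/n times n is c. *)
exists N.+1 => n /ssrnat.leP ltNn.
have nR : (n%:R != 0 :> R)%R by rewrite pnatr_eq0 -lt0n; exact: leq_ltn_trans ltNn.
have pn : (Rdiv c (INR n) * n%:R = c)%R by rewrite RdivE INRE divfK.
have [p0 p1 lt_good] := NP n _ (ltnW ltNn) pn.
have goodP E : E \in graphs n -> sparse_high s E -> exists m : nat, is_tau E 2 m /\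
    is_ceil m (Rdiv (Rplus (sqrt (Rplus (Rmult 8 (INR (max_degree E))) 1)) 5) 2).
  move=> EG /andP[large nd]; apply: (is_tau_sparse EG s3 _ large) => S S0 leS.
  rewrite ltnNge; apply: contra nd => dS; apply/existsP; exists S.
  by rewrite S0 leS.
have [lo hi] := gnp_prob_bounds p0 p1 goodP.
rewrite /R_dist Rabs_left1; last by apply/RleP; rewrite RminusE subr_le0.
apply/RltP; rewrite RoppE RminusE opprB ltrBlDl -ltrBlDr.
exact: lt_le_trans lt_good lo.
Qed.
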